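(* Let $(\mathcal{B},\Psi)$ be a braided monoidal category and $H=(H,m,u,\Delta,\varepsilon,S)$ a Hopf algebra in $\mathcal{B}$ with invertible antipode. The forgetful functor $\mathrm{F}_{\mathcal{B}}\colon {}^H_H\mathbf{YD}(\mathcal{B})\to H\text{-}\mathbf{Mod}(\mathcal{B})$ has a lax monoidal right adjoint $\mathrm{R}_{\mathcal{B}}\colon H\text{-}\mathbf{Mod}(\mathcal{B})\to {}^H_H\mathbf{YD}(\mathcal{B})$. Explicitly, $\mathrm{R}_{\mathcal{B}}$ sends an $H$-module $(V,a_V)$ to $(H\otimes V,a^{\mathrm{R}},\delta^{\mathrm{R}})$ with $$a^{\mathrm{R}}=(m\otimes\mathrm{Id}_V)(\mathrm{Id}_H\otimes\Psi_{V,H})(\mathrm{Id}_H\otimes a_V\otimes S)(\mathrm{Id}_{H\otimes H}\otimes\Psi_{H,V})(m\otimes\Delta\otimes\mathrm{Id}_V)(\mathrm{Id}_H\otimes\Psi_{H,H}\otimes\mathrm{Id}_V)(\Delta\otimes\mathrm{Id}_{H\otimes V}),$$ $$\delta^{\mathrm{R}}=\Delta\otimes\mathrm{Id}_V,$$ and sends a morphism $f$ to $\mathrm{Id}_H\otimes f$. The unit and counit of the adjunction are $\alpha_W=\delta_W\colon W\to \mathrm{R}_{\mathcal{B}}\mathrm{F}_{\mathcal{B}}(W)$ and $\beta_V=\varepsilon\otimes\mathrm{Id}_V\colon \mathrm{F}_{\mathcal{B}}\mathrm{R}_{\mathcal{B}}(V)\to V$. The lax monoidal structure consists of the morphism $I\xrightarrow{\alpha_I}\mathrm{R}_{\mathcal{B}}\mathrm{F}_{\mathcal{B}}(I)\cong\mathrm{R}_{\mathcal{B}}(I)$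 together with the natural transformation $\tau_{V,W}\colon \mathrm{R}_{\mathcal{B}}(V)\otimes\mathrm{R}_{\mathcal{B}}(W)\to\mathrm{R}_{\mathcal{B}}(V\otimes W)$, $$\tau_{V,W}=(m\otimes\mathrm{Id}_{V\otimes W})(\mathrm{Id}_H\otimes\Psi_{V,H}\otimes\mathrm{Id}_W).$$
   Context: All categories are $\Bbbk$-linear abelian monoidal categories over a field $\Bbbk$; associativity and unit isomorphisms are suppressed. $H\text{-}\mathbf{Mod}(\mathcal{B})$ is the monoidal category of left $H$-modules $(V,a_V\colon H\otimes V\to V)$ in $\mathcal{B}$, with tensor product action $a_{V\otimes W}=(a_V\otimes a_W)(\mathrm{Id}_H\otimes\Psi_{H,V}\otimes\mathrm{Id}_W)(\Delta\otimes\mathrm{Id}_{V\otimes W})$. The category ${}^H_H\mathbf{YD}(\mathcal{B})$ of $H$-Yetter–Drinfeld modules in $\mathcal{B}$ has objects $(V,a_V,\delta_V)$ with $(V,a_V)$ a left $H$-module in $\mathcal{B}$ and $\delta_V\colon V\to H\otimes V$ a left $H$-comodule structure in $\mathcal{B}$ such that $(m\otimes a_V)(\mathrm{Id}_H\otimes\Psi_{H,H}\otimes\mathrm{Id}_V)(\Delta\otimes\delta_V)=(m\otimes\mathrm{Id}_V)(\mathrm{Id}_H\otimes\Psi_{V,H})(\delta_V\otimes\mathrm{Id}_H)(a_V\otimes\mathrm{Id}_H)(\mathrm{Id}_H\otimes\Psi_{H,V})(\Delta\otimes\mathrm{Id}_V)$; morphisms are morphisms in $\mathcal{B}$ that are both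 $H$-linear and $H$-colinear; the tensor product has the action above and coaction $\delta_{V\otimes W}=(m\otimes\mathrm{Id}_{V\otimes W})(\mathrm{Id}_H\otimes\Psi_{H,V}\otimes\mathrm{Id}_W)(\delta_V\otimes\delta_W)$; it is braided by $\Psi^{\mathbf{YD}}_{V,W}=(a_W\otimes\mathrm{Id}_V)(\mathrm{Id}_H\otimes\Psi_{V,W})(\delta_V\otimes\mathrm{Id}_W)$. $\mathrm{F}_{\mathcal{B}}$ forgets the coaction. A lax monoidal functor is one equipped with a morphism $I\to \mathrm{R}(I)$ and a natural transformation $\mathrm{R}(V)\otimes\mathrm{R}(W)\to\mathrm{R}(V\otimes W)$ satisfying the associativity and unitality axioms. *)

(* Defs.v *)
Set Implicit Arguments.
Unset Strict Implicit.

Record BMC : Type := BMC_Build {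
  ob : Type;
  hom : ob -> ob -> Type;
  comp : forall a b c : ob, hom b c -> hom a b -> hom a c;
  idm : forall a : ob, hom a a;
  comp_assoc : forall a b c d (f : hom a b) (g : hom b c) (h : hom c d),
      comp h (comp g f) = comp (comp h g) f;
  comp_id_l : forall a b (f : hom a b), comp (idm b) f = f;
  comp_id_r : forall a b (f : hom a b), comp f (idm a) = f;
  tens : ob -> ob -> ob;
  tunit : ob;
  tensm : forall a a' b b' : ob, hom a a' -> hom b b' -> hom (tens a b) (tens a' b');
  tensm_id : forall a b, tensm (idm a) (idm b) = idm (tens a b);
  tensm_comp : forall a a' a'' b b' b'' (f : hom a a') (f' : hom a' a'')
      (g : hom b b') (g' : hom b' b''),
      tensm (comp f' f) (comp g' g) = comp (tensm f' g') (tensm f g);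
  assoc : forall a b c, hom (tens (tens a b) c) (tens a (tens b c));
  assoc_inv : forall a b c, hom (tens a (tens b c)) (tens (tens a b) c);
  assoc_iso1 : forall a b c, comp (assoc_inv a b c) (assoc a b c) = idm _;
  assoc_iso2 : forall a b c, comp (assoc a b c) (assoc_inv a b c) = idm _;
  assoc_nat : forall a a' b b' c c' (f : hom a a') (g : hom b b') (h : hom c c'),
      comp (assoc a' b' c') (tensm (tensm f g) h)
      = comp (tensm f (tensm g h)) (assoc a b c);
  lunit : forall a, hom (tens tunit a) a;
  lunit_inv : forall a, hom a (tens tunit a);
  lunit_iso1 : forall a, comp (lunit_inv a) (lunit a) = idm _;
  lunit_iso2 : forall a, comp (lunit a) (lunit_inv a) = idm _;
  lunit_nat : forall a a' (f : hom a a'),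
      comp (lunit a') (tensm (idm tunit) f) = comp f (lunit a);
  runit : forall a, hom (tens a tunit) a;
  runit_inv : forall a, hom a (tens a tunit);
  runit_iso1 : forall a, comp (runit_inv a) (runit a) = idm _;
  runit_iso2 : forall a, comp (runit a) (runit_inv a) = idm _;
  runit_nat : forall a a' (f : hom a a'),
      comp (runit a') (tensm f (idm tunit)) = comp f (runit a);
  pentagon : forall a b c d,
      comp (assoc a b (tens c d)) (assoc (tens a b) c d)
      = comp (tensm (idm a) (assoc b c d))
             (comp (assoc a (tens b c) d) (tensm (assoc a b c) (idm d)));
  triangle : forall a b,
      comp (tensm (idm a) (lunit b)) (assoc a tunit b) = tensm (runit a) (idm b);
  braid : forall a b, hom (tens a b) (tens b a);
  braid_inv : forall a b, hom (tens b a) (tens a b);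
  braid_iso1 : forall a b, comp (braid_inv a b) (braid a b) = idm _;
  braid_iso2 : forall a b, comp (braid a b) (braid_inv a b) = idm _;
  braid_nat : forall a a' b b' (f : hom a a') (g : hom b b'),
      comp (braid a' b') (tensm f g) = comp (tensm g f) (braid a b);
  hexagon1 : forall a b c,
      comp (assoc b c a) (comp (braid a (tens b c)) (assoc a b c))
      = comp (tensm (idm b) (braid a c))
             (comp (assoc b a c) (tensm (braid a b) (idm c)));
  hexagon2 : forall a b c,
      comp (assoc_inv c a b) (comp (braid (tens a b) c) (assoc_inv a b c))
      = comp (tensm (braid a c) (idm b))
             (comp (assoc_inv a c b) (tensm (idm a) (braid b c)))
}.

Arguments ob : clear implicits.
Arguments hom {_} _ _.
Arguments comp {_ _ _ _} _ _.
Arguments idm {_} _.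
Arguments tens {_} _ _.
Arguments tunit {_}.
Arguments tensm {_ _ _ _ _} _ _.
Arguments assoc {_} _ _ _.
Arguments assoc_inv {_} _ _ _.
Arguments lunit {_} _.
Arguments lunit_inv {_} _.
Arguments runit {_} _.
Arguments runit_inv {_} _.
Arguments braid {_} _ _.
Arguments braid_inv {_} _ _.

Declare Scope cat_scope.
Notation "g ∘ f" := (comp g f) (at level 40, left associativity) : cat_scope.
Notation "f ⊗ g" := (tensm f g) (at level 35, no associativity) : cat_scope.
Open Scope cat_scope.

(* The "middle four interchange" (Id_a ⊗ Ψ_{b,c} ⊗ Id_d), with associators:
   (a⊗b)⊗(c⊗d) -> (a⊗c)⊗(b⊗d). *)
Definition mid4 {C : BMC} (a b c d : ob C)
  : hom (tens (tens a b) (tens c d)) (tens (tens a c) (tens b d)) :=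
  assoc_inv a c (tens b d)
  ∘ (idm a ⊗ (assoc c b d ∘ (braid b c ⊗ idm d) ∘ assoc_inv b c d))
  ∘ assoc a b (tens c d).

Record Hopf (C : BMC) : Type := Hopf_Build {
  hH : ob C;
  hm : hom (tens hH hH) hH;
  hu : hom tunit hH;
  hD : hom hH (tens hH hH);
  he : hom hH tunit;
  hS : hom hH hH;
  m_assoc : hm ∘ (hm ⊗ idm hH) = hm ∘ (idm hH ⊗ hm) ∘ assoc hH hH hH;
  m_unit_l : hm ∘ (hu ⊗ idm hH) = lunit hH;
  m_unit_r : hm ∘ (idm hH ⊗ hu) = runit hH;
  D_coassoc : assoc hH hH hH ∘ (hD ⊗ idm hH) ∘ hD = (idm hH ⊗ hD) ∘ hD;
  D_counit_l : (he ⊗ idm hH) ∘ hD = lunit_inv hH;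
  D_counit_r : (idm hH ⊗ he) ∘ hD = runit_inv hH;
  D_m : hD ∘ hm = (hm ⊗ hm) ∘ mid4 hH hH hH hH ∘ (hD ⊗ hD);
  D_u : hD ∘ hu = (hu ⊗ hu) ∘ lunit_inv tunit;
  e_m : he ∘ hm = lunit tunit ∘ (he ⊗ he);
  e_u : he ∘ hu = idm tunit;
  S_l : hm ∘ (hS ⊗ idm hH) ∘ hD = hu ∘ he;
  S_r : hm ∘ (idm hH ⊗ hS) ∘ hD = hu ∘ he
}.

Arguments hH {C} _.
Arguments hm {_} _.
Arguments hu {_} _.
Arguments hD {C} _.
Arguments he {_} _.
Arguments hS {C} _.

Definition antipode_invertible {C : BMC} (A : Hopf C) : Prop :=
  exists S' : hom (hH A) (hH A), hS A ∘ S' = idm (hH A) /\ S' ∘ hS A = idm (hH A).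

Section YD.
Context {C : BMC} (A : Hopf C).
Local Notation H := (hH A).
Local Notation m := (hm A).
Local Notation u := (hu A).
Local Notation D := (hD A).
Local Notation e := (he A).
Local Notation S := (hS A).
Local Notation I := (@tunit C).

Definition is_module (V : ob C) (a : hom (tens H V) V) : Prop :=
  a ∘ (m ⊗ idm V) = a ∘ (idm H ⊗ a) ∘ assoc H H V
  /\ a ∘ (u ⊗ idm V) = lunit V.

Definition is_comodule (V : ob C) (d : hom V (tens H V)) : Prop :=
  (D ⊗ idm V) ∘ d = assoc_inv H H V ∘ (idm H ⊗ d) ∘ d
  /\ (e ⊗ idm V) ∘ d = lunit_inv V.

Definition yd_compat (V : ob C) (a : hom (tens H V) V) (d : hom V (tens H V)) : Prop :=
  (m ⊗ a) ∘ mid4 H H H V ∘ (D ⊗ d)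
  = (m ⊗ idm V) ∘ assoc_inv H H V ∘ (idm H ⊗ braid V H) ∘ assoc H V H
    ∘ (d ⊗ idm H) ∘ (a ⊗ idm H) ∘ assoc_inv H V H ∘ (idm H ⊗ braid H V)
    ∘ assoc H H V ∘ (D ⊗ idm V).

Definition is_YD (V : ob C) (a : hom (tens H V) V) (d : hom V (tens H V)) : Prop :=
  is_module a /\ is_comodule d /\ yd_compat a d.

Definition is_mod_mor {V W : ob C} (aV : hom (tens H V) V) (aW : hom (tens H W) W)
  (f : hom V W) : Prop := f ∘ aV = aW ∘ (idm H ⊗ f).

Definition is_comod_mor {V W : ob C} (dV : hom V (tens H V)) (dW : hom W (tens H W))
  (f : hom V W) : Prop := dW ∘ f = (idm H ⊗ f) ∘ dV.

Definition mod_tens_act {V W : ob C} (aV : hom (tens H V) V) (aW : hom (tens H W) W)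
  : hom (tens H (tens V W)) (tens V W) :=
  (aV ⊗ aW) ∘ mid4 H H V W ∘ (D ⊗ idm (tens V W)).

Definition comod_tens_coact {V W : ob C} (dV : hom V (tens H V)) (dW : hom W (tens H W))
  : hom (tens V W) (tens H (tens V W)) :=
  (m ⊗ idm (tens V W)) ∘ mid4 H V H W ∘ (dV ⊗ dW).

Definition unit_act : hom (tens H I) I := lunit I ∘ (e ⊗ idm I).
Definition unit_coact : hom I (tens H I) := (u ⊗ idm I) ∘ lunit_inv I.

Definition RA {V : ob C} (a : hom (tens H V) V) : hom (tens H (tens H V)) (tens H V) :=
  (m ⊗ idm V) ∘ assoc_inv H H V
  ∘ (idm H ⊗ braid V H)
  ∘ (idm H ⊗ ((a ⊗ S) ∘ assoc_inv H V H))
  ∘ (idm H ⊗ ((idm H ⊗ braid H V) ∘ assoc H H V))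
  ∘ (m ⊗ (D ⊗ idm V))
  ∘ mid4 H H H V
  ∘ (D ⊗ idm (tens H V)).

Definition RD (V : ob C) : hom (tens H V) (tens H (tens H V)) :=
  assoc H H V ∘ (D ⊗ idm V).

Definition Rmor {V W : ob C} (f : hom V W) : hom (tens H V) (tens H W) := idm H ⊗ f.

Definition beta (V : ob C) : hom (tens H V) V := lunit V ∘ (e ⊗ idm V).

Definition eta : hom I (tens H I) := unit_coact.   (* = α_I, R F(I) = R(I) *)

Definition tau (V W : ob C) : hom (tens (tens H V) (tens H W)) (tens H (tens V W)) :=
  (m ⊗ idm (tens V W)) ∘ mid4 H V H W.

Definition R_functor : Prop :=
  (forall (V : ob C) (a : hom (tens H V) V), is_module a -> is_YD (RA a) (RD V))
  /\ (forall (V W : ob C) (aV : hom (tens H V) V) (aW : hom (tens H W) W) (f : hom V W),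
        is_module aV -> is_module aW -> is_mod_mor aV aW f ->
        is_mod_mor (RA aV) (RA aW) (Rmor f) /\ is_comod_mor (RD V) (RD W) (Rmor f))
  /\ (forall V : ob C, Rmor (idm V) = idm (tens H V))
  /\ (forall (U V W : ob C) (f : hom U V) (g : hom V W),
        Rmor (g ∘ f) = Rmor g ∘ Rmor f).

(* F ⊣ R with unit α_W = δ_W and counit β_V *)
Definition F_R_adjunction : Prop :=
  (forall (W : ob C) (a : hom (tens H W) W) (d : hom W (tens H W)),
     is_YD a d -> is_mod_mor a (RA a) d /\ is_comod_mor d (RD W) d)
  /\ (forall (W W' : ob C) (a : hom (tens H W) W) (d : hom W (tens H W))
        (a' : hom (tens H W') W') (d' : hom W' (tens H W')) (g : hom W W'),
        is_YD a d -> is_YD a' d' -> is_mod_mor a a' g -> is_comod_mor d d' g ->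
        Rmor g ∘ d = d' ∘ g)
  /\ (forall (V : ob C) (a : hom (tens H V) V), is_module a -> is_mod_mor (RA a) a (beta V))
  /\ (forall (V V' : ob C) (a : hom (tens H V) V) (a' : hom (tens H V') V') (f : hom V V'),
        is_module a -> is_module a' -> is_mod_mor a a' f ->
        f ∘ beta V = beta V' ∘ Rmor f)
  /\ (forall (W : ob C) (a : hom (tens H W) W) (d : hom W (tens H W)),
        is_YD a d -> beta W ∘ d = idm W)
  /\ (forall (V : ob C) (a : hom (tens H V) V),
        is_module a -> Rmor (beta V) ∘ RD V = idm (tens H V)).

Definition R_lax_monoidal : Prop :=
  (is_mod_mor unit_act (RA unit_act) eta /\ is_comod_mor unit_coact (RD I) eta)
  /\ (forall (V W : ob C) (aV : hom (tens H V) V) (aW : hom (tens H W) W),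
        is_module aV -> is_module aW ->
        is_mod_mor (mod_tens_act (RA aV) (RA aW)) (RA (mod_tens_act aV aW)) (tau V W)
        /\ is_comod_mor (comod_tens_coact (RD V) (RD W)) (RD (tens V W)) (tau V W))
  /\ (forall (V V' W W' : ob C) (aV : hom (tens H V) V) (aV' : hom (tens H V') V')
        (aW : hom (tens H W) W) (aW' : hom (tens H W') W') (f : hom V V') (g : hom W W'),
        is_module aV -> is_module aV' -> is_module aW -> is_module aW' ->
        is_mod_mor aV aV' f -> is_mod_mor aW aW' g ->
        tau V' W' ∘ (Rmor f ⊗ Rmor g) = Rmor (f ⊗ g) ∘ tau V W)
  /\ (forall (U V W : ob C) (aU : hom (tens H U) U) (aV : hom (tens H V) V)
        (aW : hom (tens H W) W),
        is_module aU -> is_module aV -> is_module aW ->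
        Rmor (assoc U V W) ∘ tau (tens U V) W ∘ (tau U V ⊗ idm (tens H W))
        = tau U (tens V W) ∘ (idm (tens H U) ⊗ tau V W)
          ∘ assoc (tens H U) (tens H V) (tens H W))
  /\ (forall (V : ob C) (aV : hom (tens H V) V), is_module aV ->
        Rmor (lunit V) ∘ tau I V ∘ (eta ⊗ idm (tens H V)) = lunit (tens H V))
  /\ (forall (V : ob C) (aV : hom (tens H V) V), is_module aV ->
        Rmor (runit V) ∘ tau V I ∘ (idm (tens H V) ⊗ eta) = runit (tens H V)).

End YD.

(* Main.v *)
From Corelib Require Import ssreflect.
Require Import Defs.

Set Implicit Arguments.
Unset Strict Implicit.

(* Let R(V) carry the right H-action (g ⊗ v)·k = gk ⊗ v and the diagonal map
   d(h, g ⊗ v) = h₁g ⊗ h₂v, braidings being understood.  For every right H-module Y the operator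
   Φ(f)(h, x) = f(h₁, x)·h₂ on morphisms f : H ⊗ X -> Y is invertible, its inverse using S in
   place of the last h₂.  The action a^R is exactly Φ⁻¹(d), and the Yetter-Drinfeld condition for
   (W, a, δ) says Φ(δ a) = d (id ⊗ δ).  Hence each identity involving a^R can be checked after
   applying Φ, where a^R becomes d and S disappears; (anti)multiplicativity of
   S is never needed.

   To calculate as in a strict category, a morphism f : a -> b is replaced by the natural family
   of the f ⊗ X, with all tensor products bracketed to the right. *)

(** * Strictification *)

Section Strictification.
Context {C : BMC}.

Inductive shape : Type :=
| Atom (a : ob C)
| Unit
| Tens (s t : shape).

Fixpoint obj (s : shape) : ob C :=
  match s with
  | Atom a => a
  | Unit => tunit
  | Tens s t => tens (obj s) (obj t)
  end.

(* [act s X] is [obj s ⊗ X] with all brackets to the right and units dropped.  As [act] turns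
   [Tens] into composition of functions, associativity holds by conversion. *)
Fixpoint act (s : shape) (X : ob C) : ob C :=
  match s with
  | Atom a => tens a X
  | Unit => X
  | Tens s t => act s (act t X)
  end.

Fixpoint actm (s : shape) : forall X Y : ob C, hom X Y -> hom (act s X) (act s Y) :=
  match s return forall X Y : ob C, hom X Y -> hom (act s X) (act s Y) with
  | Atom a => fun X Y f => idm a ⊗ f
  | Unit => fun X Y f => f
  | Tens s t => fun X Y f => actm s (actm t f)
  end.
Arguments actm s {X Y} f.

Fixpoint flat (s : shape) : forall X : ob C, hom (tens (obj s) X) (act s X) :=
  match s return forall X : ob C, hom (tens (obj s) X) (act s X) with
  | Atom a => fun X => idm (tens a X)
  | Unit => fun X => lunit X
  | Tens s t => fun X => flat s (act t X) ∘ (idm (obj s) ⊗ flat t X) ∘ assoc (obj s) (obj t) X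
  end.

Fixpoint flat_inv (s : shape) : forall X : ob C, hom (act s X) (tens (obj s) X) :=
  match s return forall X : ob C, hom (act s X) (tens (obj s) X) with
  | Atom a => fun X => idm (tens a X)
  | Unit => fun X => lunit_inv X
  | Tens s t => fun X =>
      assoc_inv (obj s) (obj t) X ∘ ((idm (obj s) ⊗ flat_inv t X) ∘ flat_inv s (act t X))
  end.

(* The opaque key keeps unification from unfolding [hat]. *)
Fact hat_key : unit.
Proof. exact tt. Qed.

Definition hat (s t : shape) (f : hom (obj s) (obj t)) (X : ob C) : hom (act s X) (act t X) :=
  let: tt := hat_key in flat t X ∘ ((f ⊗ idm X) ∘ flat_inv s X).

Lemma hatE (s t : shape) (f : hom (obj s) (obj t)) (X : ob C) :
  hat f X = flat t X ∘ ((f ⊗ idm X) ∘ flat_inv s X).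
Proof. unfold hat; case: hat_key; reflexivity. Qed.

Definition br (s t : shape) (X : ob C) : hom (act s (act t X)) (act t (act s X)) :=
  @hat (Tens s t) (Tens t s) (braid (obj s) (obj t)) X.

(** * Naturality and invertibility of the flattening maps *)

Lemma comp_assoc' (a b c d : ob C) (f : hom a b) (g : hom b c) (h : hom c d) :
  h ∘ g ∘ f = h ∘ (g ∘ f).
Proof. symmetry; apply comp_assoc. Qed.

Lemma whisker_comp (a b c d : ob C) (f : hom b c) (g : hom c d) :
  idm a ⊗ (g ∘ f) = (idm a ⊗ g) ∘ (idm a ⊗ f).
Proof. rewrite -tensm_comp comp_id_l; reflexivity. Qed.

Lemma comp_whisker (a b c d : ob C) (f : hom b c) (g : hom c d) :
  (g ∘ f) ⊗ idm a = (g ⊗ idm a) ∘ (f ⊗ idm a).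
Proof. rewrite -tensm_comp comp_id_l; reflexivity. Qed.

Lemma tensm_split (a a' b b' : ob C) (f : hom a a') (g : hom b b') :
  f ⊗ g = (f ⊗ idm b') ∘ (idm a ⊗ g).
Proof. rewrite -tensm_comp comp_id_l comp_id_r; reflexivity. Qed.

Lemma interchange (a a' b b' : ob C) (f : hom a a') (g : hom b b') :
  (f ⊗ idm b') ∘ (idm a ⊗ g) = (idm a' ⊗ g) ∘ (f ⊗ idm b).
Proof. rewrite -!tensm_comp !comp_id_l !comp_id_r; reflexivity. Qed.

Lemma actm_comp (s : shape) (X Y Z : ob C) (f : hom X Y) (g : hom Y Z) :
  actm s (g ∘ f) = actm s g ∘ actm s f.
Proof.
revert X Y Z f g; induction s as [a| |s IHs t IHt]; intros X Y Z f g; simpl.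
- apply whisker_comp.
- reflexivity.
- rewrite IHt IHs; reflexivity.
Qed.

Lemma actm_id (s : shape) (X : ob C) : actm s (idm X) = idm (act s X).
Proof.
revert X; induction s as [a| |s IHs t IHt]; intros X; simpl.
- apply tensm_id.
- reflexivity.
- rewrite IHt IHs; reflexivity.
Qed.

Lemma flat_iso1 (s : shape) (X : ob C) : flat_inv s X ∘ flat s X = idm _.
Proof.
revert X; induction s as [a| |s IHs t IHt]; intros X; simpl.
- apply comp_id_l.
- apply lunit_iso1.
- rewrite !comp_assoc' (comp_assoc _ (flat s _) (flat_inv s _)) IHs comp_id_l.
  rewrite (comp_assoc _ (_ ⊗ flat t _)) -whisker_comp IHt tensm_id comp_id_l.
  apply assoc_iso1.
Qed.

Lemma flat_iso2 (s : shape) (X : ob C) : flat s X ∘ flat_inv s X = idm _.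
Proof.
revert X; induction s as [a| |s IHs t IHt]; intros X; simpl.
- apply comp_id_l.
- apply lunit_iso2.
- rewrite !comp_assoc' (comp_assoc _ (assoc_inv _ _ _)) assoc_iso2 comp_id_l.
  rewrite (comp_assoc _ (_ ⊗ flat_inv t _)) -whisker_comp IHt tensm_id comp_id_l.
  apply IHs.
Qed.

Lemma flat_nat (s : shape) (X Y : ob C) (g : hom X Y) :
  flat s Y ∘ (idm (obj s) ⊗ g) = actm s g ∘ flat s X.
Proof.
revert X Y g; induction s as [a| |s IHs t IHt]; intros X Y g; simpl.
- rewrite comp_id_l comp_id_r; reflexivity.
- apply lunit_nat.
- rewrite !comp_assoc' -tensm_id assoc_nat.
  rewrite (comp_assoc (assoc _ _ _) (_ ⊗ _) (_ ⊗ flat t _)) -whisker_comp IHt.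
  rewrite whisker_comp !comp_assoc IHs; reflexivity.
Qed.

Lemma flat_inv_nat (s : shape) (X Y : ob C) (g : hom X Y) :
  flat_inv s Y ∘ actm s g = (idm (obj s) ⊗ g) ∘ flat_inv s X.
Proof.
rewrite -(comp_id_r (flat_inv s Y ∘ actm s g)) -(flat_iso2 s X).
rewrite !comp_assoc' (comp_assoc (flat_inv s X) (flat s X) (actm s g)) -flat_nat.
rewrite !comp_assoc flat_iso1 comp_id_l; reflexivity.
Qed.

Lemma hat_nat (s t : shape) (f : hom (obj s) (obj t)) (X Y : ob C) (g : hom X Y) :
  hat f Y ∘ actm s g = actm t g ∘ hat f X.
Proof.
rewrite !hatE !comp_assoc' flat_inv_nat.
rewrite (comp_assoc (flat_inv s X) (_ ⊗ g)) interchange.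
rewrite !comp_assoc flat_nat; reflexivity.
Qed.

(** * Faithfulness of strictification and its effect on structural morphisms *)

Lemma runit_inj (a b : ob C) (f g : hom a b) : f ⊗ idm tunit = g ⊗ idm tunit -> f = g.
Proof.
intros E; apply (f_equal (fun k => runit b ∘ k ∘ runit_inv a)) in E.
rewrite !runit_nat !comp_assoc' runit_iso2 !comp_id_r in E; exact E.
Qed.

(** The component at [tunit] already determines a morphism: [flat] is invertible and tensoring with
    the unit object is faithful. *)
Lemma hat_inj (s t : shape) (f g : hom (obj s) (obj t)) :
  (forall X, hat f X = hat g X) -> f = g.
Proof.
intros E; specialize (E tunit); rewrite !hatE in E.
assert (E' : f ⊗ idm tunit = g ⊗ idm tunit).
{ apply (f_equal (fun k => flat_inv t tunit ∘ k ∘ flat s tunit)) in E.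
  rewrite !comp_assoc' flat_iso1 !comp_id_r !comp_assoc flat_iso1 !comp_id_l in E.
  exact E. }
exact (runit_inj E').
Qed.

Lemma hat_comp (r s t : shape) (f : hom (obj r) (obj s)) (g : hom (obj s) (obj t)) (X : ob C) :
  @hat r t (g ∘ f) X = hat g X ∘ hat f X.
Proof.
rewrite !hatE comp_whisker !comp_assoc' (comp_assoc _ (flat s X) (flat_inv s X)).
rewrite flat_iso1 comp_id_l; reflexivity.
Qed.

Lemma hat_id (s : shape) (X : ob C) : @hat s s (idm (obj s)) X = idm _.
Proof. rewrite !hatE tensm_id comp_id_l; apply flat_iso2. Qed.

Lemma hat_tens (s s' t t' : shape) (f : hom (obj s) (obj s')) (g : hom (obj t) (obj t'))
  (X : ob C) :
  @hat (Tens s t) (Tens s' t') (f ⊗ g) X = hat f (act t' X) ∘ actm s (hat g X).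
Proof.
rewrite !hatE; simpl; rewrite !comp_assoc'.
rewrite (comp_assoc _ (_ ⊗ _) (assoc _ _ _)) assoc_nat !comp_assoc'.
rewrite (comp_assoc _ (assoc_inv _ _ _)) assoc_iso2 comp_id_l.
rewrite flat_inv_nat !whisker_comp (tensm_split f).
rewrite !comp_assoc'.
rewrite (comp_assoc _ (f ⊗ _) (_ ⊗ flat t' X)) -(interchange f (flat t' X)) !comp_assoc'.
reflexivity.
Qed.

(** By the pentagon, the associator followed by one flattening of a triple product is the other
    flattening. *)
Lemma hat_assoc (r s t : shape) (X : ob C) :
  @hat (Tens (Tens r s) t) (Tens r (Tens s t)) (assoc (obj r) (obj s) (obj t)) X
  = idm (act r (act s (act t X))).
Proof.
rewrite hatE.
rewrite comp_assoc.
enough (E : flat (Tens r (Tens s t)) X ∘ (assoc (obj r) (obj s) (obj t) ⊗ idm X)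
            = flat (Tens (Tens r s) t) X).
{ etransitivity; [exact (f_equal (fun k => k ∘ _) E)|exact (flat_iso2 (Tens (Tens r s) t) X)]. }
simpl; rewrite !whisker_comp !comp_assoc'; f_equal.
rewrite -pentagon -(tensm_id (obj r) (obj s)).
rewrite (comp_assoc _ (_ ⊗ flat t X) (assoc _ _ _)) assoc_nat !comp_assoc'.
reflexivity.
Qed.

Lemma hat_assoc_inv (r s t : shape) (X : ob C) :
  @hat (Tens r (Tens s t)) (Tens (Tens r s) t) (assoc_inv (obj r) (obj s) (obj t)) X
  = idm (act r (act s (act t X))).
Proof.
pose proof (@hat_comp (Tens r (Tens s t)) (Tens (Tens r s) t) (Tens r (Tens s t))
  (assoc_inv _ _ _) (assoc _ _ _) X) as E.
rewrite hat_assoc in E; cbn [obj] in E; rewrite assoc_iso2 in E.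
symmetry; etransitivity; [|etransitivity; [exact E|exact (comp_id_l _)]].
symmetry; exact (hat_id (Tens r (Tens s t)) X).
Qed.

Lemma whisker_unit_inj (a b : ob C) (f g : hom a b) :
  idm tunit ⊗ f = idm tunit ⊗ g -> f = g.
Proof.
intros E; apply (f_equal (fun k => lunit b ∘ k ∘ lunit_inv a)) in E.
rewrite !lunit_nat !comp_assoc' lunit_iso2 !comp_id_r in E; exact E.
Qed.

(* Kelly: this is not an axiom of a monoidal category but follows from the pentagon and the
   triangle, after whiskering with the unit object. *)
Lemma lunit_tens (a b : ob C) : lunit (tens a b) ∘ assoc tunit a b = lunit a ⊗ idm b.
Proof.
apply whisker_unit_inj.
assert (E : forall f g : hom (tens tunit (tens (tens tunit a) b)) (tens tunit (tens a b)),
  f ∘ (assoc tunit (tens tunit a) b ∘ (assoc tunit tunit a ⊗ idm b))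
  = g ∘ (assoc tunit (tens tunit a) b ∘ (assoc tunit tunit a ⊗ idm b)) -> f = g).
{ intros f g E.
  apply (f_equal (fun k => k ∘ ((assoc_inv tunit tunit a ⊗ idm b)
                                ∘ assoc_inv tunit (tens tunit a) b))) in E.
  rewrite !comp_assoc' !(comp_assoc _ (assoc_inv _ _ _ ⊗ _) (assoc _ _ _ ⊗ _)) in E.
  rewrite -!comp_whisker assoc_iso2 !tensm_id !comp_id_l in E.
  rewrite !assoc_iso2 !comp_id_r in E; exact E. }
apply E.
rewrite whisker_comp comp_assoc' -pentagon comp_assoc triangle.
rewrite comp_assoc -assoc_nat comp_assoc' -comp_whisker triangle.
rewrite assoc_nat tensm_id; reflexivity.
Qed.

Lemma hat_lunit (s : shape) (X : ob C) :
  @hat (Tens Unit s) s (lunit (obj s)) X = idm (act s X).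
Proof.
rewrite !hatE comp_assoc.
enough (E : flat s X ∘ (lunit (obj s) ⊗ idm X) = flat (Tens Unit s) X).
{ etransitivity; [exact (f_equal (fun k => k ∘ _) E)|exact (flat_iso2 (Tens Unit s) X)]. }
simpl; rewrite -lunit_tens lunit_nat comp_assoc; reflexivity.
Qed.

Lemma hat_runit (s : shape) (X : ob C) :
  @hat (Tens s Unit) s (runit (obj s)) X = idm (act s X).
Proof.
rewrite !hatE comp_assoc.
enough (E : flat s X ∘ (runit (obj s) ⊗ idm X) = flat (Tens s Unit) X).
{ etransitivity; [exact (f_equal (fun k => k ∘ _) E)|exact (flat_iso2 (Tens s Unit) X)]. }
simpl; rewrite -triangle comp_assoc; reflexivity.
Qed.

Lemma hat_lunit_inv (s : shape) (X : ob C) :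
  @hat s (Tens Unit s) (lunit_inv (obj s)) X = idm (act s X).
Proof.
pose proof (@hat_comp s (Tens Unit s) s (lunit_inv _) (lunit _) X) as E.
rewrite hat_lunit in E; cbn [obj] in E; rewrite lunit_iso2 in E.
symmetry; etransitivity; [|etransitivity; [exact E|exact (comp_id_l _)]].
symmetry; exact (hat_id s X).
Qed.

Lemma hat_runit_inv (s : shape) (X : ob C) :
  @hat s (Tens s Unit) (runit_inv (obj s)) X = idm (act s X).
Proof.
pose proof (@hat_comp s (Tens s Unit) s (runit_inv _) (runit _) X) as E.
rewrite hat_runit in E; cbn [obj] in E; rewrite runit_iso2 in E.
symmetry; etransitivity; [|etransitivity; [exact E|exact (comp_id_l _)]].
symmetry; exact (hat_id s X).
Qed.

(** * The braiding of strict families *)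

Lemma br_natl (s s' t : shape) (f : hom (obj s) (obj s')) (X : ob C) :
  br s' t X ∘ hat f (act t X) = actm t (hat f X) ∘ br s t X.
Proof.
pose proof (f_equal (fun k => @hat (Tens s t) (Tens t s') k X)
  (braid_nat f (idm (obj t)))) as E; cbv beta in E.
rewrite (@hat_comp _ (Tens s' t) _ _ _ X) (@hat_comp _ (Tens t s) _ _ _ X) !hat_tens in E.
rewrite !hat_id actm_id comp_id_l comp_id_r in E; exact E.
Qed.

Lemma br_natr (s t t' : shape) (g : hom (obj t) (obj t')) (X : ob C) :
  br s t' X ∘ actm s (hat g X) = hat g (act s X) ∘ br s t X.
Proof.
pose proof (f_equal (fun k => @hat (Tens s t) (Tens t' s) k X)
  (braid_nat (idm (obj s)) g)) as E; cbv beta in E.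
rewrite (@hat_comp _ (Tens s t') _ _ _ X) (@hat_comp _ (Tens t s) _ _ _ X) !hat_tens in E.
rewrite !hat_id actm_id comp_id_l comp_id_r in E; exact E.
Qed.

Lemma br_nat (s t : shape) (X Y : ob C) (g : hom X Y) :
  br s t Y ∘ actm s (actm t g) = actm t (actm s g) ∘ br s t X.
Proof. exact (@hat_nat (Tens s t) (Tens t s) _ X Y g). Qed.

Lemma br_tens_r (r s t : shape) (X : ob C) :
  br r (Tens s t) X = actm s (br r t X) ∘ br r s (act t X).
Proof.
pose proof (f_equal (fun k => @hat (Tens (Tens r s) t) (Tens s (Tens t r)) k X)
  (hexagon1 (obj r) (obj s) (obj t))) as E; cbv beta in E.
rewrite (@hat_comp _ (Tens (Tens s t) r) _ _ _ X) (@hat_comp _ (Tens r (Tens s t)) _ _ _ X) in E.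
rewrite (@hat_comp _ (Tens s (Tens r t)) _ _ _ X) (@hat_comp _ (Tens (Tens s r) t) _ _ _ X) in E.
rewrite !hat_assoc !hat_tens !hat_id in E; simpl in E.
rewrite !actm_id ?comp_id_l ?comp_id_r in E.
etransitivity; [exact E|]; reflexivity.
Qed.

Lemma br_tens_l (r s t : shape) (X : ob C) :
  br (Tens r s) t X = br r t (act s X) ∘ actm r (br s t X).
Proof.
pose proof (f_equal (fun k => @hat (Tens r (Tens s t)) (Tens (Tens t r) s) k X)
  (hexagon2 (obj r) (obj s) (obj t))) as E; cbv beta in E.
rewrite (@hat_comp _ (Tens t (Tens r s)) _ _ _ X) (@hat_comp _ (Tens (Tens r s) t) _ _ _ X) in E.
rewrite (@hat_comp _ (Tens (Tens r t) s) _ _ _ X) (@hat_comp _ (Tens r (Tens t s)) _ _ _ X) in E.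
rewrite !hat_assoc_inv !hat_tens !hat_id in E; simpl in E.
rewrite !actm_id ?comp_id_l ?comp_id_r in E.
etransitivity; [exact E|]; reflexivity.
Qed.

Definition br_inv (s t : shape) (X : ob C) : hom (act t (act s X)) (act s (act t X)) :=
  @hat (Tens t s) (Tens s t) (braid_inv (obj s) (obj t)) X.

Lemma br_iso1 (s t : shape) (X : ob C) : br_inv s t X ∘ br s t X = idm _.
Proof.
unfold br_inv, br.
rewrite -(@hat_comp (Tens s t) (Tens t s) (Tens s t) _ _ X); simpl.
rewrite braid_iso1; exact (hat_id (Tens s t) X).
Qed.

(** Naturality along [lunit tunit] together with the hexagon makes this braiding idempotent; being
    invertible, it is the identity. *)
Lemma br_unit_l (t : shape) (X : ob C) : br Unit t X = idm (act t X).
Proof.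
pose proof (@br_natl (Tens Unit Unit) Unit t (lunit tunit) X) as E.
rewrite (hat_lunit Unit) (hat_lunit Unit) actm_id br_tens_l in E; simpl in E.
rewrite comp_id_l comp_id_r in E.
apply (f_equal (fun k => br_inv Unit t X ∘ k)) in E; simpl in E.
pose proof (br_iso1 Unit t X) as F; simpl in F.
rewrite comp_assoc F comp_id_l in E; symmetry; exact E.
Qed.

Lemma br_unit_r (s : shape) (X : ob C) : br s Unit X = idm (act s X).
Proof.
pose proof (@br_natr s (Tens Unit Unit) Unit (lunit tunit) X) as E.
rewrite (hat_lunit Unit) (hat_lunit Unit) actm_id br_tens_r in E; simpl in E.
rewrite comp_id_l comp_id_r in E.
apply (f_equal (fun k => br_inv s Unit X ∘ k)) in E; simpl in E.
pose proof (br_iso1 s Unit X) as F; simpl in F.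
rewrite comp_assoc F comp_id_l in E; symmetry; exact E.
Qed.

End Strictification.

Arguments actm {C} s {X Y} f.
Opaque hat br.

(** * Rewriting in right-nested composites *)

Section Steps.
Context {C : BMC}.

Lemma on_tail (a b c : ob C) (p : hom b c) (f g : hom a b) : f = g -> p ∘ f = p ∘ g.
Proof. move=> ->; reflexivity. Qed.
Lemma group2 (a b c d : ob C) (f : hom c d) (g : hom b c) (k : hom a b) (r : hom b d) :
  f ∘ g = r -> f ∘ (g ∘ k) = r ∘ k.
Proof. move=> <-; apply comp_assoc. Qed.
Lemma group3 (a b c d e : ob C) (f : hom d e) (g : hom c d) (h : hom b c) (k : hom a b)
  (r : hom b e) : f ∘ (g ∘ h) = r -> f ∘ (g ∘ (h ∘ k)) = r ∘ k.
Proof. move=> <-; rewrite !comp_assoc; reflexivity. Qed.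
Lemma group4 (a b c d e e' : ob C) (f : hom e e') (f' : hom d e) (g : hom c d) (h : hom b c)
  (k : hom a b) (r : hom b e') :
  f ∘ (f' ∘ (g ∘ h)) = r -> f ∘ (f' ∘ (g ∘ (h ∘ k))) = r ∘ k.
Proof. move=> <-; rewrite !comp_assoc; reflexivity. Qed.

Lemma under2 (s : shape) (a b c : ob C) (f : hom b c) (g : hom a b) (r : hom a c) :
  f ∘ g = r -> actm s f ∘ actm s g = actm s r.
Proof. move=> <-; symmetry; apply actm_comp. Qed.
Lemma under3 (s : shape) (a b c d : ob C) (f : hom c d) (g : hom b c) (h : hom a b)
  (r : hom a d) : f ∘ (g ∘ h) = r -> actm s f ∘ (actm s g ∘ actm s h) = actm s r.
Proof. move=> <-; rewrite !actm_comp; reflexivity. Qed.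
Lemma under4 (s : shape) (a b c d e : ob C) (f : hom d e) (g : hom c d) (h : hom b c)
  (k : hom a b) (r : hom a e) : f ∘ (g ∘ (h ∘ k)) = r ->
  actm s f ∘ (actm s g ∘ (actm s h ∘ actm s k)) = actm s r.
Proof. move=> <-; rewrite !actm_comp; reflexivity. Qed.

End Steps.

(** * Tactics for reification, rewriting under whiskerings and strictification *)

Ltac reify a :=
  lazymatch a with
  | @tens ?C ?x ?y => let s := reify x in let t := reify y in constr:(@Tens C s t)
  | @tunit ?C => constr:(@Unit C)
  | @obj ?C ?s => s
  | ?x => constr:(Atom x)
  end.

Ltac unders n :=
  lazymatch goal with
  | |- @tensm ?C ?a ?a _ _ (idm ?a) _ ∘ _ = _ =>
      lazymatch n with
      | 2 => apply (@under2 C (Atom a))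
      | 3 => apply (@under3 C (Atom a))
      | 4 => apply (@under4 C (Atom a))
      end
  | |- @actm ?C ?s _ _ _ ∘ _ = _ =>
      lazymatch n with
      | 2 => apply (@under2 C s)
      | 3 => apply (@under3 C s)
      | 4 => apply (@under4 C s)
      end
  end.

Ltac in_context n tac := first [tac tt | unders n; in_context n tac].

Ltac in_slice n tac :=
  lazymatch n with
  | 2 => first [apply group2; in_context n tac | in_context n tac]
  | 3 => first [apply group3; in_context n tac | in_context n tac]
  | 4 => first [apply group4; in_context n tac | in_context n tac]
  end.

Ltac search n tac := first [in_slice n tac | apply on_tail; search n tac].

Ltac norm :=
  cbn [act actm];
  rewrite ?actm_comp ?whisker_comp ?actm_comp ?whisker_comp ?comp_assoc';
  repeat first [rewrite tensm_id | rewrite actm_id];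
  rewrite ?comp_id_l ?comp_id_r ?comp_assoc'.

(** The middle term of the transitivity is an existential variable filled in by [search]. Only the
    left-hand side is searched, hence the frequent use of [symmetry] in the proofs below. *)
Ltac step n tac := etransitivity; [search n tac|]; norm.

(* [fwd n E] (resp. [bwd n E]) rewrites with [E] from left to right (resp. right to left) at the
   first [n] consecutive factors of the left-hand side where it applies, possibly inside whiskerings. *)
Tactic Notation "fwd" constr(n) uconstr(E) := step n ltac:(fun _ => apply E).
Tactic Notation "bwd" constr(n) uconstr(E) := step n ltac:(fun _ => symmetry; apply E).

(* Oriented interchange law: whatever acts further to the right is performed last, and
   generators are moved past braidings. *)
Ltac slide_one _ :=
  lazymatch goal with
  | |- @hat ?C ?s ?t ?f ?Y ∘ _ = _ => apply (@hat_nat C s t f _ Y _)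
  | |- @br ?C ?s ?t ?Y ∘ @hat _ ?s' ?s ?f _ = _ =>
      etransitivity; [apply (@br_natl C s' s t f Y)|rewrite ?br_tens_l ?br_unit_l; reflexivity]
  | |- @br ?C ?s ?t ?Y ∘ _ = _ => first
     [ apply (@br_nat C s t _ Y _)
     | match goal with |- _ ∘ ?g = _ => match g with context [@hat _ ?t' t ?f ?Z] =>
       etransitivity; [apply (@br_natr C s t' t f Z)|rewrite ?br_tens_r ?br_unit_r; reflexivity]
       end end ]
  end.
Ltac slide := repeat step 2 slide_one.
Ltac slides := slide; symmetry; slide; symmetry.

Ltac push_one :=
  match goal with
  | |- context [@hat ?C ?r ?t (@comp _ _ ?b _ ?g ?f) ?X] =>
      let s := reify b in rewrite (@hat_comp C r s t f g X)
  | |- context [@hat ?C (Tens ?s ?t) (Tens ?s' ?t') (@tensm _ _ _ _ _ ?f ?g) ?X] =>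
      rewrite (@hat_tens C s s' t t' f g X)
  | |- context [@hat ?C ?s _ (idm _) ?X] => rewrite (@hat_id C s X)
  | |- context [@hat ?C (Tens (Tens ?r ?s) ?t) _ (assoc _ _ _) ?X] =>
      rewrite (@hat_assoc C r s t X)
  | |- context [@hat ?C (Tens ?r (Tens ?s ?t)) _ (assoc_inv _ _ _) ?X] =>
      rewrite (@hat_assoc_inv C r s t X)
  | |- context [@hat ?C _ ?s (lunit _) ?X] => rewrite (@hat_lunit C s X)
  | |- context [@hat ?C ?s _ (lunit_inv _) ?X] => rewrite (@hat_lunit_inv C s X)
  | |- context [@hat ?C _ ?s (runit _) ?X] => rewrite (@hat_runit C s X)
  | |- context [@hat ?C ?s _ (runit_inv _) ?X] => rewrite (@hat_runit_inv C s X)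
  | |- context [@hat ?C (Tens ?s ?t) (Tens ?t ?s) (braid ?a ?b) ?X] =>
      change (@hat C (Tens s t) (Tens t s) (braid a b) X) with (@br C s t X)
  end.

Ltac push :=
  unfold mid4; repeat push_one; cbn [act actm];
  rewrite ?br_tens_l ?br_tens_r ?br_unit_l ?br_unit_r; norm.

Ltac strictify :=
  lazymatch goal with
  | |- @eq (@hom ?C ?a ?b) _ _ =>
      let s := reify a in let t := reify b in
      apply (@hat_inj C s t); let X := fresh "X" in intro X; push
  end.

(** * The cofree Yetter-Drinfeld module *)

Section HopfLaws.
Context {C : BMC} (A : Hopf C).
Notation H := (hH A).
Notation h := (Atom (hH A)).
Notation M X := (@hat _ (Tens h h) h (hm A) X).
Notation U X := (@hat _ Unit h (hu A) X).
Notation D X := (@hat _ h (Tens h h) (hD A) X).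
Notation E X := (@hat _ h Unit (he A) X).
Notation S X := (@hat _ h h (hS A) X).

(** Strictifies a known equation at the object [X] found in the context, so that it can be used on
    strictified goals. *)
Ltac hatted E :=
  let F := fresh in pose proof E as F;
  lazymatch type of F with
  | @eq (@hom ?C ?a ?b) ?f ?g =>
    let s := reify a in let t := reify b in
    lazymatch goal with X : ob _ |- _ =>
    apply (f_equal (fun k => @hat C s t k X)) in F; cbv beta in F; revert F; push end
  end.
Ltac transport E := hatted E; let F := fresh in intro F; exact F.

(** * The Hopf algebra axioms in strict form *)

Lemma M_assoc X : M X ∘ M (tens H X) = M X ∘ (idm H ⊗ M X).
Proof. transport (m_assoc A). Qed.
Lemma M_unit_l X : M X ∘ U (tens H X) = idm _.
Proof. transport (m_unit_l A). Qed.
Lemma M_unit_r X : M X ∘ (idm H ⊗ U X) = idm _.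
Proof. transport (m_unit_r A). Qed.
Lemma D_coassoc_hat X : D (tens H X) ∘ D X = (idm H ⊗ D X) ∘ D X.
Proof. transport (D_coassoc A). Qed.
Lemma D_counit_l_hat X : E (tens H X) ∘ D X = idm _.
Proof. transport (D_counit_l A). Qed.
Lemma D_counit_r_hat X : (idm H ⊗ E X) ∘ D X = idm _.
Proof. transport (D_counit_r A). Qed.
Lemma D_mul X : D X ∘ M X = M (tens H X) ∘ ((idm H ⊗ (idm H ⊗ M X)) ∘
   ((idm H ⊗ br h h (tens H X)) ∘ (D _ ∘ (idm H ⊗ D X)))).
Proof. transport (D_m A). Qed.
Lemma D_unit X : D X ∘ U X = U (tens H X) ∘ U X.
Proof. transport (D_u A). Qed.
Lemma E_mul X : E X ∘ M X = E X ∘ (idm H ⊗ E X).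
Proof. transport (e_m A). Qed.
Lemma E_unit X : E X ∘ U X = idm _.
Proof. transport (e_u A). Qed.
Lemma S_left X : M X ∘ (S (tens H X) ∘ D X) = U X ∘ E X.
Proof. transport (S_l A). Qed.
Lemma S_right X : M X ∘ ((idm H ⊗ S X) ∘ D X) = U X ∘ E X.
Proof. transport (S_r A). Qed.

(** By coassociativity, h₂ and h₃ may pass x together as one factor that is split only
    afterwards. *)
Lemma coact_split (x : @shape C) X :
  (idm H ⊗ br h x (tens H X)) ∘ ((idm H ⊗ (idm H ⊗ br h x X)) ∘
    (D (tens H (act x X)) ∘ D (act x X)))
  = (idm H ⊗ actm x (D X)) ∘ ((idm H ⊗ br h x X) ∘ D (act x X)).
Proof.
fwd 2 D_coassoc_hat. bwd 2 (@br_tens_l C h h x). fwd 2 (@br_natl C h (Tens h h) x).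
reflexivity.
Qed.

(* The prefix [z] lets the convolution variable sit behind other tensor factors, as needed for
   the second variable in [RA_mul]. *)
Section Convolution.
Variables x y z : @shape C.
Variable act_r : forall X, hom (act y (tens H X)) (act y X).
Hypothesis act_r_mul : forall X, act_r X ∘ act_r (tens H X) = act_r X ∘ actm y (M X).
Hypothesis act_r_unit : forall X, act_r X ∘ actm y (U X) = idm (act y X).

Implicit Types f : forall X, hom (act z (tens H (act x X))) (act y X).

Definition natural f := forall X Y (k : hom X Y),
  f Y ∘ actm z (idm H ⊗ actm x k) = actm y k ∘ f X.

(** This is the operator Φ, in elements f(z, h₁, x)·h₂; [convS] has S(h₂) in place of h₂. *)
Definition conv f X : hom (act z (tens H (act x X))) (act y X) :=
  act_r X ∘ (f (tens H X) ∘ actm z ((idm H ⊗ br h x X) ∘ D (act x X))).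

Definition convS f X : hom (act z (tens H (act x X))) (act y X) :=
  act_r X ∘ (f (tens H X) ∘ actm z ((idm H ⊗ actm x (S X)) ∘
    ((idm H ⊗ br h x X) ∘ D (act x X)))).

(** In elements, f(h₁, x)·S(h₂)·h₃ = f(h₁, x)ε(h₂) = f(h, x). The opposite composite has h₂S(h₃)
    instead. *)
Lemma conv_convS f : natural f -> forall X, conv (convS f) X = f X.
Proof.
move=> nf X; unfold conv, convS; norm.
fwd 2 (@hat_nat C h (Tens h h)).
fwd 2 D_coassoc_hat.
bwd 2 (@br_tens_l C h h x).
fwd 2 (@br_natl C h (Tens h h) x).
fwd 2 nf.
fwd 2 nf.
fwd 2 act_r_mul.
fwd 3 S_left.
fwd 2 act_r_unit.
bwd 2 nf.
bwd 2 (@br_natl C h Unit x).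
rewrite ?br_unit_l; norm.
fwd 2 D_counit_r_hat.
reflexivity.
Qed.

Lemma convS_conv f : natural f -> forall X, convS (conv f) X = f X.
Proof.
move=> nf X; unfold conv, convS; norm.
fwd 2 (@hat_nat C h (Tens h h)).
fwd 2 (@hat_nat C h (Tens h h)).
fwd 2 D_coassoc_hat.
fwd 2 (@br_nat C h x).
bwd 2 (@br_tens_l C h h x).
fwd 2 (@br_natl C h (Tens h h) x).
fwd 2 nf.
fwd 2 nf.
fwd 2 act_r_mul.
fwd 3 S_right.
fwd 2 act_r_unit.
bwd 2 nf.
bwd 2 (@br_natl C h Unit x).
rewrite ?br_unit_l; norm.
fwd 2 D_counit_r_hat.
reflexivity.
Qed.

(** The cancellation principle behind most identities for [RA]: [convS] is a left inverse of
    [conv]. *)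
Lemma conv_inj f g : natural f -> natural g -> (forall X, conv f X = conv g X) ->
  forall X, f X = g X.
Proof.
move=> nf ng E X; rewrite -(convS_conv nf) -(convS_conv ng).
unfold convS; rewrite E; reflexivity.
Qed.
End Convolution.

(** * The right action on H ⊗ V and the diagonal map *)

Definition ract (v : shape) X : hom (act (Tens h v) (tens H X)) (act (Tens h v) X) :=
  let: tt := hat_key in M (act v X) ∘ (idm H ⊗ br v h X).

Lemma ractE v X : ract v X = M (act v X) ∘ (idm H ⊗ br v h X).
Proof. unfold ract; case: hat_key; reflexivity. Qed.

Lemma ract_nat v X Y (g : hom X Y) :
  ract v Y ∘ actm (Tens h v) (idm H ⊗ g) = actm (Tens h v) g ∘ ract v X.
Proof. rewrite !ractE; norm; slides; reflexivity. Qed.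

(** With [ract_unit], this supplies the hypotheses of section [Convolution] for Y = H ⊗ V. *)
Lemma ract_mul v X : ract v X ∘ ract v (tens H X) = ract v X ∘ actm (Tens h v) (M X).
Proof. rewrite !ractE; norm; slides. symmetry. bwd 2 M_assoc. slide. reflexivity. Qed.

Lemma ract_unit v X : ract v X ∘ actm (Tens h v) (U X) = idm _.
Proof.
rewrite !ractE; norm. fwd 2 (@br_natr C v Unit h). rewrite br_unit_r; norm.
apply M_unit_r.
Qed.

Lemma E_ract v X : E (act v X) ∘ ract v X = E (act v X) ∘ (idm H ⊗ actm v (E X)).
Proof.
rewrite ractE; norm. fwd 2 E_mul. bwd 2 (@br_natr C v h Unit (he A)).
rewrite br_unit_r; norm. reflexivity.
Qed.

Section Module.
Variables (v : @shape C) (a : hom (tens H (obj v)) (obj v)).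
Notation a_ X := (@hat C (Tens h v) v a X).
Hypothesis a_mul : forall X, a_ X ∘ M (act v X) = a_ X ∘ (idm H ⊗ a_ X).
Hypothesis a_unit : forall X, a_ X ∘ U (act v X) = idm _.

(** The map d: the diagonal action on the tensor product of the regular module H with V. *)
Definition dact X : hom (tens H (tens H (act v X))) (tens H (act v X)) :=
  let: tt := hat_key in M (act v X) ∘ ((idm H ⊗ (idm H ⊗ a_ X)) ∘
  ((idm H ⊗ br h h (act v X)) ∘ D (tens H (act v X)))).

Lemma dactE X : dact X = M (act v X) ∘ ((idm H ⊗ (idm H ⊗ a_ X)) ∘
  ((idm H ⊗ br h h (act v X)) ∘ D (tens H (act v X)))).
Proof. unfold dact; case: hat_key; reflexivity. Qed.

Lemma dact_nat X Y (g : hom X Y) : dact Y ∘ (idm H ⊗ (idm H ⊗ actm v g))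
  = (idm H ⊗ actm v g) ∘ dact X.
Proof. rewrite !dactE; norm; slides; reflexivity. Qed.

Lemma dact_mul X : dact X ∘ M (tens H (act v X)) = dact X ∘ (idm H ⊗ dact X).
Proof. rewrite !dactE; norm. fwd 2 D_mul. slide.
fwd 2 a_mul. symmetry. slide. bwd 2 M_assoc. slide. reflexivity.
Qed.

Lemma dact_unit X : dact X ∘ U (tens H (act v X)) = idm _.
Proof.
rewrite !dactE; norm. fwd 2 D_unit. bwd 2 (@hat_nat C Unit h).
fwd 2 (@br_natl C Unit h h). rewrite br_unit_l; norm.
bwd 2 (@hat_nat C Unit h).
fwd 2 a_unit. fwd 2 M_unit_l. reflexivity.
Qed.

(** Left and right multiplication on the factor H commute. *)
Lemma dact_ract X : dact X ∘ (idm H ⊗ ract v X) = ract v X ∘ dact (tens H X).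
Proof.
rewrite !dactE !ractE; norm. slide. bwd 2 M_assoc. slide. symmetry. slide. reflexivity.
Qed.

Notation RA_ X := (@hat C (Tens h (Tens h v)) (Tens h v) (RA a) X).

(** [RA] splits the second leg of Δ(h), whereas [convS] of [dact] splits the first; coassociativity
    reconciles them. *)
Lemma RA_convS X : RA_ X = @convS (Tens h v) (Tens h v) Unit (ract v) dact X.
Proof.
unfold RA; push. unfold convS; rewrite ractE dactE; norm. slide. symmetry.
rewrite ?br_tens_r; norm. slide.
fwd 2 D_coassoc_hat. bwd 2 (@br_tens_l C h h h). fwd 2 (@br_natl C h (Tens h h) h). slide.
reflexivity.
Qed.

(** Writing h▷x for [RA], this reads (h₁▷x)·h₂ = d(h, x), a characterization free of S. *)
Lemma RA_ract X :
  ract v X ∘ (RA_ (tens H X) ∘ ((idm H ⊗ br h (Tens h v) X) ∘ D (tens H (act v X)))) = dact X.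
Proof.
etransitivity; [|exact (@conv_convS (Tens h v) (Tens h v) Unit (ract v)
  (ract_mul v) (ract_unit v) dact dact_nat X)].
unfold conv; rewrite RA_convS; reflexivity.
Qed.

(** Since Δ(1) = 1 ⊗ 1, Φ changes nothing at h = 1, and the unit law of d remains. *)
Lemma RA_unit X : RA_ X ∘ U (tens H (act v X)) = idm _.
Proof.
rewrite -[RHS]dact_unit -RA_ract; norm. symmetry.
fwd 2 D_unit. bwd 2 (@hat_nat C Unit h).
fwd 2 (@br_natl C Unit h (Tens h v)). rewrite br_unit_l; norm.
slide.
fwd 2 (@ract_unit v). reflexivity.
Qed.

(** Φ is applied in h and then in k. The right side becomes d(h, (k₁▷x)·k₂) = d(h, d(k, x)) = d(hk,
    x). The left side becomes (h₁k₁▷x)·h₂·k₂, which is also d(hk, x) because Δ is multiplicative. *)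
Lemma RA_mul X : RA_ X ∘ M (tens H (act v X)) = RA_ X ∘ (idm H ⊗ RA_ X).
Proof.
move: X; apply (@conv_inj (Tens h (Tens h v)) (Tens h v) Unit (ract v)
  (ract_mul v) (ract_unit v)
  (fun X => RA_ X ∘ M (tens H (act v X))) (fun X => RA_ X ∘ (idm H ⊗ RA_ X))).
1,2: move=> X Y k; norm; slide; reflexivity.
have E2 X : @conv (Tens h (Tens h v)) (Tens h v) Unit (ract v)
   (fun X => RA_ X ∘ (idm H ⊗ RA_ X)) X = dact X ∘ (idm H ⊗ RA_ X).
{ unfold conv; norm.
  bwd 2 (@br_natr C h (Tens h (Tens h v)) (Tens h v) (RA a)).
  bwd 2 (@hat_nat C h (Tens h h)).
  fwd 4 RA_ract. reflexivity. }
move=> X; rewrite E2; move: X.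
(* The second use of Φ, in k, with prefix [h] holding the first variable. *)
apply (@conv_inj (Tens h v) (Tens h v) h (ract v)
  (ract_mul v) (ract_unit v)
  (fun X => @conv (Tens h (Tens h v)) (Tens h v) Unit (ract v)
     (fun X => RA_ X ∘ M (tens H (act v X))) X)
  (fun X => dact X ∘ (idm H ⊗ RA_ X))).
- move=> X Y k; unfold conv; norm.
  fwd 2 (@hat_nat C h (Tens h h)).
  fwd 2 (@br_nat C h (Tens h (Tens h v))). slide. fwd 2 (@ract_nat v). reflexivity.
- move=> X Y k; norm. slide. fwd 2 (dact_nat). reflexivity.
- move=> X. unfold conv; norm. symmetry. bwd 2 dact_ract. fwd 4 RA_ract.
  bwd 2 dact_mul. rewrite -RA_ract; norm.
  fwd 2 D_mul. symmetry. fwd 2 (@ract_mul v).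
  rewrite !br_tens_r; norm.
  slide. symmetry. slide. reflexivity.
Qed.

(** * The Yetter-Drinfeld condition for the cofree module, and linearity of the counit *)

Lemma D_ract X : D (act v X) ∘ ract v X = (idm H ⊗ ract v X) ∘ (M _ ∘
  ((idm H ⊗ br (Tens h v) h (tens H X)) ∘ (D _ ∘ (idm H ⊗ actm v (D X))))).
Proof.
rewrite !ractE; norm. fwd 2 D_mul. rewrite !br_tens_l; norm. slide.
symmetry; slide. symmetry. bwd 2 (@br_natr C v h (Tens h h) (hD A)). rewrite br_tens_r; norm. slide.
reflexivity.
Qed.

Lemma D_dact X : D (act v X) ∘ dact X = M (tens H (act v X)) ∘ ((idm H ⊗ (idm H ⊗ dact X)) ∘
  ((idm H ⊗ br h h (tens H (act v X))) ∘ (D _ ∘ (idm H ⊗ D (act v X))))).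
Proof.
rewrite !dactE; norm. fwd 2 D_mul. slide.
symmetry; slide. symmetry. fwd 2 D_coassoc_hat. bwd 2 (@br_natr C h h (Tens h h) (hD A)).
rewrite br_tens_r; norm. slide. bwd 2 (@hat_nat C h (Tens h h)).
bwd 2 (@br_tens_l C h h h). fwd 2 (@br_natl C h (Tens h h) h). slide.
reflexivity.
Qed.

(** Φ is taken for H ⊗ H ⊗ V with the right action on the last two factors. Both sides then become
    the coaction of d(h, x): the left by [D_dact], the right by [D_ract]. *)
Lemma RA_yd X : M (tens H (act v X)) ∘ ((idm H ⊗ (idm H ⊗ RA_ X)) ∘
  ((idm H ⊗ br h h (tens H (act v X))) ∘ (D _ ∘ (idm H ⊗ D (act v X))))) =
  M (tens H (act v X)) ∘ ((idm H ⊗ br (Tens h v) h X) ∘ (D (act v (tens H X)) ∘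
  (RA_ (tens H X) ∘ ((idm H ⊗ br h (Tens h v) X) ∘ D (tens H (act v X)))))).
Proof.
move: X; apply (@conv_inj (Tens h v) (Tens h (Tens h v)) Unit (fun X => idm H ⊗ ract v X)).
- move=> X; norm. fwd 2 (@ract_mul v). reflexivity.
- move=> X; norm. fwd 2 (@ract_unit v). reflexivity.
- move=> X Y k; norm; rewrite ?br_tens_l ?br_tens_r; norm; slides; reflexivity.
- move=> X Y k; norm; rewrite ?br_tens_l ?br_tens_r; norm; slides; reflexivity.
- move=> X; unfold conv; norm.
  transitivity (D (act v X) ∘ dact X); last first.
  + rewrite -RA_ract; norm. fwd 2 D_ract. symmetry.
    fwd 2 (@hat_nat C h (Tens h h)). fwd 4 (@coact_split (Tens h v)).
    norm. slide. bwd 2 (@hat_nat C h (Tens h h)). symmetry. reflexivity.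
  + rewrite D_dact -RA_ract; norm. symmetry.
    bwd 2 (@br_natl C h (Tens h h) h). rewrite br_tens_l br_tens_r; norm.
    bwd 2 D_coassoc_hat. slide. symmetry. slide. bwd 2 (@br_natr C h h (Tens h h) (hD A)). rewrite br_tens_r; norm. slide.
    reflexivity.
Qed.

(** Here V carries the trivial right action through ε. As ε is multiplicative, Φ turns the left side
    into ε(h₁g)h₂v = ε(g)hv, and the right side agrees by the counit law. *)
Lemma beta_RA X : E (act v X) ∘ RA_ X = a_ X ∘ (idm H ⊗ E (act v X)).
Proof.
move: X; apply (@conv_inj (Tens h v) v Unit (fun X => actm v (E X))).
- move=> X; norm. bwd 2 (@hat_nat C h Unit). bwd 2 E_mul. reflexivity.
- move=> X; norm. fwd 2 E_unit. reflexivity.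
- move=> X Y k; norm; slides; reflexivity.
- move=> X Y k; norm; slides; reflexivity.
- move=> X; unfold conv; norm.
  bwd 2 (@hat_nat C h Unit). bwd 2 (@E_ract v). fwd 4 RA_ract.
  rewrite dactE; norm. fwd 2 E_mul. slide.
  bwd 2 (@br_natr C h h Unit (he A)). rewrite br_unit_r; norm. slide.
  fwd 2 D_counit_l_hat. symmetry.
  rewrite br_tens_r; norm. slide.
  bwd 2 (@br_natr C h h Unit (he A)). rewrite br_unit_r; norm.
  bwd 2 (@hat_nat C (Tens h v) v). bwd 2 (@br_natl C h Unit v). rewrite br_unit_l; norm.
  bwd 2 (@hat_nat C h (Tens h h)). fwd 2 D_counit_r_hat. reflexivity.
Qed.

(** * Linearity of the unit of the adjunction *)

Section CoYD.
Variable d : hom (obj v) (tens H (obj v)).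
Notation d_ X := (@hat C v (Tens h v) d X).
Hypothesis yd : forall X, M (act v X) ∘ ((idm H ⊗ (idm H ⊗ a_ X)) ∘
  ((idm H ⊗ br h h (act v X)) ∘ (D _ ∘ (idm H ⊗ d_ X)))) =
  M (act v X) ∘ ((idm H ⊗ br v h X) ∘ (d_ (tens H X) ∘
  (a_ (tens H X) ∘ ((idm H ⊗ br h v X) ∘ D (act v X))))).

(** Under Φ the two sides become the two sides of [yd], by [RA_ract]. *)
Lemma coact_RA X : d_ X ∘ a_ X = RA_ X ∘ (idm H ⊗ d_ X).
Proof.
move: X; apply (@conv_inj v (Tens h v) Unit (ract v) (ract_mul v) (ract_unit v)).
- move=> X Y k; norm; slides; reflexivity.
- move=> X Y k; norm; slides; reflexivity.
- move=> X; unfold conv; norm. symmetry.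
  bwd 2 (@br_natr C h v (Tens h v) d). bwd 2 (@hat_nat C h (Tens h h)).
  fwd 4 RA_ract. rewrite dactE ractE; norm. exact (yd X).
Qed.
End CoYD.

End Module.

(** * The lax monoidal structure *)

Lemma RA_unit_act X : U X ∘ E X = @hat C (Tens h (Tens h Unit)) (Tens h Unit) (RA (unit_act A)) X
  ∘ (idm H ⊗ U X).
Proof.
move: X; apply (@conv_inj Unit (Tens h Unit) Unit (ract Unit) (ract_mul Unit) (ract_unit Unit)).
- move=> X Y k; norm; slides; reflexivity.
- move=> X Y k; norm; slides; reflexivity.
(* Both sides become h under Φ: ε(h₁)1·h₂ on the left, d(h, 1) = h₁ε(h₂) on the right. *)
- move=> X; unfold conv; norm. symmetry.
  have RE := @RA_ract Unit (unit_act A) X; rewrite br_tens_r br_unit_r actm_id comp_id_l in RE.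
  bwd 2 (@br_natr C h Unit h (hu A)). bwd 2 (@hat_nat C h (Tens h h)). fwd 4 RE.
  rewrite dactE. unfold unit_act; push.
  bwd 2 (@br_natl C h Unit h). rewrite br_unit_l; norm.
  fwd 2 (@hat_nat C h (Tens h h)). fwd 2 (@hat_nat C h Unit). fwd 2 D_counit_r_hat.
  fwd 2 M_unit_r. symmetry. rewrite ractE br_unit_l; norm. fwd 2 M_unit_l.
  fwd 2 D_counit_l_hat. reflexivity.
Qed.

Lemma mod_tens_actE (v w : @shape C) (a : hom (tens H (obj v)) (obj v))
  (b : hom (tens H (obj w)) (obj w)) X :
  @hat C (Tens h (Tens v w)) (Tens v w) (mod_tens_act a b) X =
  @hat C (Tens h v) v a (act w X) ∘ ((idm H ⊗ actm v (@hat C (Tens h w) w b X)) ∘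
   ((idm H ⊗ br h v (act w X)) ∘ D (act v (act w X)))).
Proof. unfold mod_tens_act; push. reflexivity. Qed.

(* τ is the right action of H on R(V), the factor H being that of R(W). *)
Lemma tauE (v w : @shape C) X :
  @hat C (Tens (Tens h v) (Tens h w)) (Tens h (Tens v w)) (tau A (obj v) (obj w)) X
  = ract v (act w X).
Proof. unfold tau; push; rewrite ractE; reflexivity. Qed.

Section Tau.
Variables (v w : @shape C) (a : hom (tens H (obj v)) (obj v)) (b : hom (tens H (obj w)) (obj w)).
Notation a_ X := (@hat C (Tens h v) v a X).
Notation b_ X := (@hat C (Tens h w) w b X).
Notation RAv X := (@hat C (Tens h (Tens h v)) (Tens h v) (RA a) X).
Notation RAw X := (@hat C (Tens h (Tens h w)) (Tens h w) (RA b) X).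
Notation RAvw X := (@hat C (Tens h (Tens h (Tens v w))) (Tens h (Tens v w))
  (RA (@mod_tens_act C A (obj v) (obj w) a b)) X).

(** τ(x, y)·k = τ(x, y·k), by associativity of m. *)
Lemma ract_tens X : ract (Tens v w) X ∘ ract v (act w (tens H X))
  = ract v (act w X) ∘ (idm H ⊗ actm v (ract w X)).
Proof.
rewrite !ractE; rewrite br_tens_l; norm. slide. symmetry. slide. bwd 2 M_assoc. slide. reflexivity.
Qed.

(** Let y = g ⊗ w. Φ sends the left side to τ(h₁▷x, (h₂▷y)·h₃) = τ(h₁▷x, d(h₂, y)) = (h₁▷x)·h₂·g ⊗
    h₃w = d(h₁, x)·g ⊗ h₂w, which is d(h, τ(x, y)), the image of the right side. *)
Lemma tau_RA X : ract v (act w X) ∘ (RAv (tens H (act w X)) ∘ ((idm H ⊗ (idm H ⊗ actm v (RAw X)))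
   ∘ ((idm H ⊗ br h (Tens h v) (tens H (act w X))) ∘ D (tens H (act v (tens H (act w X)))))))
  = RAvw X ∘ (idm H ⊗ ract v (act w X)).
Proof.
move: X; apply (@conv_inj (Tens (Tens h v) (Tens h w)) (Tens h (Tens v w)) Unit
  (ract (Tens v w)) (ract_mul _) (ract_unit _)).
- move=> X Y k; norm; slides. fwd 2 (@ract_nat v). reflexivity.
- move=> X Y k; norm. fwd 2 (@ract_nat v). slide. reflexivity.
- move=> X; unfold conv; norm.
  have E := @RA_ract (Tens v w) (@mod_tens_act C A (obj v) (obj w) a b) X.
  (* The braiding is natural for morphisms under [hat], so [ract] is first turned back into τ. *)
  symmetry. rewrite -(tauE v w (tens H X)).
  bwd 2 (@br_natr C h (Tens (Tens h v) (Tens h w)) (Tens h (Tens v w))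
    (tau A (obj v) (obj w))).
  bwd 2 (@hat_nat C h (Tens h h)). fwd 4 E. clear E. rewrite !tauE. symmetry.
  fwd 2 ract_tens. bwd 2 (@hat_nat C (Tens h (Tens h v)) (Tens h v)).
  rewrite (@br_tens_r C h (Tens h v) (Tens h w)); norm.
  fwd 2 (@hat_nat C h (Tens h h)).
  fwd 2 (@hat_nat C h (Tens h h)).
  fwd 2 (@br_nat C h (Tens h v)). fwd 4 (@coact_split (Tens h v)).
  fwd 4 (@RA_ract w b). rewrite dactE; norm. slide.
  (* The action of h₂g is split so that h₂ acts first and [RA_ract] applies on V. *)
  fwd 2 (@ract_nat v). bwd 2 (@ract_mul v). fwd 2 (@ract_nat v).
  bwd 2 (@hat_nat C (Tens h (Tens h v)) (Tens h v)). bwd 3 (@coact_split (Tens h v)).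
  bwd 2 (@hat_nat C h (Tens h h)). fwd 4 (@RA_ract v a).
  rewrite !dactE !mod_tens_actE !ractE; rewrite br_tens_r; norm. slide.
  symmetry. slide. bwd 2 M_assoc. slide. symmetry.
  fwd 2 D_coassoc_hat. bwd 2 (@br_tens_l C h h h). fwd 2 (@br_natl C h (Tens h h) h).
  bwd 2 (@hat_nat C (Tens h v) v).
  fwd 2 (@br_natl C (Tens h v) v h). rewrite br_tens_l; norm.
  (* Naturality of the braiding along a braiding: the Yang-Baxter equation. *)
  bwd 2 (@br_tens_l C v h h). fwd 2 (@br_natl C (Tens h v) (Tens v h) h (braid H (obj v))).
  change (@hat C (Tens h v) (Tens v h) (braid H (obj v))) with (@br C h v).
  rewrite !br_tens_l; norm. slide. symmetry.
  bwd 2 (@hat_nat C (Tens h h) h). bwd 2 (@br_natl C h (Tens h h) h).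
  rewrite br_tens_l; norm. slide. reflexivity.
Qed.
End Tau.

(** * Assembly of the functor, the adjunction and the lax structure *)

Lemma R_functor_holds : R_functor A.
Proof.
split; [|split; [|split]].
- move=> V a [a_mul a_unit].
  have am X : @hat C (Tens h (Atom V)) (Atom V) a X ∘ M (tens V X)
    = @hat C (Tens h (Atom V)) (Atom V) a X ∘ (idm H ⊗ @hat C (Tens h (Atom V)) (Atom V) a X).
  { transport a_mul. }
  have au X : @hat C (Tens h (Atom V)) (Atom V) a X ∘ U (tens V X) = idm _.
  { transport a_unit. }
  split; [split|split; [split|]].
  + strictify. exact (@RA_mul (Atom V) a am X).
  + strictify. exact (@RA_unit (Atom V) a au X).
  + unfold RD; strictify. exact (D_coassoc_hat _).
  + unfold RD; strictify. exact (D_counit_l_hat _).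
  + unfold yd_compat, RD; strictify.
    etransitivity; [exact (@RA_yd (Atom V) a X)|].
    rewrite br_tens_l br_tens_r; norm. reflexivity.
- move=> V W aV aW f _ _ E; split.
  + unfold is_mod_mor, Rmor; strictify.
    unfold is_mod_mor in E; hatted E => F.
    (* The action occurs once in [RA]; there linearity of f is used, and all other factors slide
       past f. *)
    unfold RA; push. symmetry. slide. bwd 2 F. slide. symmetry. slide. reflexivity.
  + unfold is_comod_mor, RD, Rmor; strictify. slides. reflexivity.
- move=> V; apply tensm_id.
- move=> W V V' f g; apply whisker_comp.
Qed.

Lemma F_R_adjunction_holds : F_R_adjunction A.
Proof.
split; [|split; [|split; [|split; [|split]]]].
- move=> W a d [_ [[d_coassoc _] yd]]; split.
  + unfold is_mod_mor; strictify. apply (@coact_RA (Atom W) a d).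
    clear X; move=> X. unfold yd_compat in yd; transport yd.
  (* Colinearity of δ into the cofree comodule is its coassociativity. *)
  + unfold is_comod_mor, RD; strictify. transport d_coassoc.
- move=> W W' a d a' d' g _ _ _ E. unfold is_comod_mor in E. symmetry; exact E.
- move=> V a [a_mul a_unit]. unfold is_mod_mor, beta; strictify.
  exact (@beta_RA (Atom V) a X).
- move=> V V' a a' f _ _ _. unfold beta, Rmor; strictify. slides. reflexivity.
(* The triangle identities are the counit laws of δ and of Δ. *)
- move=> W a d [_ [[_ d_counit] _]]. unfold beta; strictify.
  transport d_counit.
- move=> V a _. unfold beta, Rmor, RD; strictify. exact (D_counit_r_hat _).
Qed.

Lemma unit_actE X : @hat C (Tens h Unit) Unit (unit_act A) X = E X.
Proof. unfold unit_act; push; reflexivity. Qed.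

Lemma R_lax_monoidal_holds : R_lax_monoidal A.
Proof.
split; [split|split; [|split; [|split; [|split]]]].
- unfold is_mod_mor, eta, unit_coact; strictify. rewrite unit_actE. exact (RA_unit_act X).
- unfold is_comod_mor, RD, eta, unit_coact; strictify. rewrite D_unit.
  apply (@hat_nat C Unit h).
- move=> V W a b _ _; split.
  + unfold is_mod_mor; strictify. rewrite (@mod_tens_actE (Tens h (Atom V)) (Tens h (Atom W)) (RA a) (RA b)).
    rewrite !(tauE (Atom V) (Atom W)); norm. exact (@tau_RA (Atom V) (Atom W) a b X).
  (* Colinearity of τ comes from multiplicativity of Δ. *)
  + unfold is_comod_mor, RD, tau, comod_tens_coact; strictify.
    fwd 2 D_mul. slide. symmetry. slide. symmetry.
    bwd 2 (@br_natr C (Atom V) h (Tens h h) (hD A)). rewrite br_tens_r; norm. slide.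
    reflexivity.
- move=> V V' W W' a a' b b' f g _ _ _ _ _ _. unfold tau, Rmor; strictify.
  slides. reflexivity.
- move=> V1 V2 V3 a1 a2 a3 _ _ _. unfold tau, Rmor; strictify.
  slides. symmetry. bwd 2 M_assoc. slide. reflexivity.
- move=> V a _. unfold tau, Rmor, eta, unit_coact; strictify. exact (M_unit_l _).
- move=> V a _. unfold tau, Rmor, eta, unit_coact; strictify.
  fwd 2 (@br_natr C (Atom V) Unit h). rewrite br_unit_r; norm. exact (M_unit_r _).
Qed.

End HopfLaws.

Theorem theorem3p10 (C : BMC) (A : Hopf C) (HSinv : antipode_invertible A) :
  R_functor A /\ F_R_adjunction A /\ R_lax_monoidal A.
Proof.
split; [|split].
- exact (R_functor_holds A).
- exact (F_R_adjunction_holds A).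
- exact (R_lax_monoidal_holds A).
Qed.
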